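(* Let $$g(x,y;u,v)=\sum_{n\ge 1}\ \sum_{\substack{\pi\in\mathcal{S}_{0012}(n)\\ \pi \text{ does not end in } 0}} x^n y^{\mathrm{asc}(\pi)}u^{\mathrm{fwd}(\pi)}v^{\mathrm{zero}(\pi)}.$$ Then $$g(x,y;u,1)=g(x,y;1,u)=\frac{uxy(1-ux)\kappa-u^2x^2y}{(1-u)(1-ux)+uxy},$$ where $$\kappa=\kappa(x,y)=\frac{1-x(y+1)-\sqrt{(1-x(y+1))^2-4x^2y}}{2xy}.$$
   Context: An ascent in a sequence $x_1\cdots x_k$ is an index $j$ with $x_j<x_{j+1}$; $\mathrm{asc}(x)$ is the number of ascents. An ascent sequence of length $n$ is a sequence $x_1\cdots x_n$ of non-negative integers with $x_1=0$ and $x_i\le\mathrm{asc}(x_1\cdots x_{i-1})+1$ for $1<i\le n$. A sequence $\pi$ contains a pattern $\tau=\tau_1\cdots\tau_m$ (a sequence of non-negative integers) if there are indices $f(1)<\cdots<f(m)$ such that for all $i,j$: $\pi_{f(i)}<\pi_{f(j)}$ iff $\tau_i<\tau_j$, and $\pi_{f(i)}>\pi_{f(j)}$ iff $\tau_i>\tau_j$; otherwise $\pi$ avoids $\tau$. $\mathcal{S}_\tau(n)$ is the set of ascent sequences of length $n$ avoiding $\tau$. $\mathrm{fwd}(x)$ is the length of the maximal final (contiguous) weakly decreasing segment of $x$; $\mathrm{zero}(x)$ is the number of $0$'s in $x$. The square root is the formal power series branch, so $\kappa$ is a formal power series in $x$ with $\kappa(0,y)=0$. *)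

(* Defs.v *)
From HB Require Import structures.
From mathcomp Require Import all_boot all_order all_algebra.
From mathcomp Require Import boolp classical_sets.

Set Implicit Arguments.
Unset Strict Implicit.
Unset Printing Implicit Defensive.

Import GRing.Theory.
Local Open Scope ring_scope.

Record fps (R : Type) := Fps { fpscoef : nat -> R }.

Section FpsRing.
Variable R : idomainType.
Implicit Types a b c s t : fps R.

Lemma fpsP a b : (forall n, fpscoef a n = fpscoef b n) -> a = b.
Proof. by case: a b => f [g] /= fg; congr Fps; apply: funext. Qed.

HB.instance Definition _ := gen_eqMixin (fps R).
HB.instance Definition _ := gen_choiceMixin (fps R).

Definition fps_add a b := Fps (fun n => fpscoef a n + fpscoef b n).
Definition fps_opp a := Fps (fun n => - fpscoef a n).
Definition fpsC (c : R) := Fps (fun n => if n == 0%N then c else 0).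
Definition fpsX := Fps (fun n => (n == 1%N)%:R : R).
Definition fps_mul a b :=
  Fps (fun n => \sum_(i < n.+1) fpscoef a i * fpscoef b (n - i)).

Fact fps_addA : associative fps_add.
Proof. by move=> a b c; apply: fpsP => n /=; rewrite addrA. Qed.
Fact fps_addC : commutative fps_add.
Proof. by move=> a b; apply: fpsP => n /=; rewrite addrC. Qed.
Fact fps_add0 : left_id (fpsC 0) fps_add.
Proof. by move=> a; apply: fpsP => n /=; rewrite if_same add0r. Qed.
Fact fps_addN : left_inverse (fpsC 0) fps_opp fps_add.
Proof. by move=> a; apply: fpsP => n /=; rewrite if_same addNr. Qed.

HB.instance Definition _ :=
  GRing.isZmodule.Build (fps R) fps_addA fps_addC fps_add0 fps_addN.

Definition fps_trunc m a : {poly R} := \poly_(i < m) fpscoef a i.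

Lemma fps_mul_trunc m n a b : (n < m)%N ->
  fpscoef (fps_mul a b) n = (fps_trunc m a * fps_trunc m b)`_n.
Proof.
move=> nm; rewrite coefM /=; apply: eq_bigr => i _; rewrite !coef_poly.
have im : (i < m)%N by apply: leq_ltn_trans nm; rewrite -ltnS.
by rewrite im (leq_ltn_trans (leq_subr _ _) nm).
Qed.

Fact fps_mulC : commutative fps_mul.
Proof.
by move=> a b; apply: fpsP => n; rewrite !(@fps_mul_trunc n.+1) // mulrC.
Qed.

Fact fps_mulA : associative fps_mul.
Proof.
move=> a b c; apply: fpsP => n.
transitivity ((fps_trunc n.+1 a * (fps_trunc n.+1 b * fps_trunc n.+1 c))`_n).
  rewrite /= coefM; apply: eq_bigr => i _.
  rewrite coef_poly ltn_ord -(@fps_mul_trunc n.+1) //.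
  by rewrite ltnS leq_subr.
rewrite mulrA /= coefM; apply: eq_bigr => i _.
by rewrite [X in _ * X = _]coef_poly ltnS leq_subr -(@fps_mul_trunc n.+1).
Qed.

Fact fps_mul1 : left_id (fpsC 1) fps_mul.
Proof.
move=> a; apply: fpsP => n /=.
by rewrite big_ord_recl /= mul1r subn0 big1 ?addr0 // => i _; rewrite mul0r.
Qed.

Fact fps_mulDl : left_distributive fps_mul fps_add.
Proof.
move=> a b c; apply: fpsP => n /=; rewrite -big_split /=.
by apply: eq_bigr => i _; rewrite mulrDl.
Qed.

Fact fps_1neq0 : fpsC 1 != 0 :> fps R.
Proof.
apply/eqP => /(congr1 (fun a => fpscoef a 0)) /= /eqP.
by rewrite oner_eq0.
Qed.

HB.instance Definition _ := GRing.Zmodule_isComNzRing.Build (fps R)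
  fps_mulA fps_mulC fps_mul1 fps_mulDl fps_1neq0.

Lemma fps_coef0B a b : fpscoef (a - b) 0 = fpscoef a 0 - fpscoef b 0.
Proof. by []. Qed.

Lemma fps_coef0M a b : fpscoef (a * b) 0 = fpscoef a 0 * fpscoef b 0.
Proof. by rewrite /= big_ord_recl big_ord0 addr0. Qed.

Definition fps_unit : {pred fps R} := fun a => `[< exists b, b * a = 1 >].
Definition fps_inv a : fps R :=
  if a \in fps_unit then xget 0 [set b | b * a = 1] else a.

Fact fps_mulV : {in fps_unit, left_inverse 1 fps_inv *%R}.
Proof.
move=> a ua; rewrite /fps_inv ua.
by move/asboolP: ua => /(@xgetPex _ 0 [set b | b * a = 1]).
Qed.
Fact fps_unitPl a b : b * a = 1 -> fps_unit a.
Proof. by move=> ba; apply/asboolP; exists b. Qed.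
Fact fps_inv_out : {in [predC fps_unit], fps_inv =1 id}.
Proof. by move=> a; rewrite inE /fps_inv /= => /negbTE ->. Qed.

HB.instance Definition _ := GRing.ComNzRing_hasMulInverse.Build (fps R)
  fps_mulV fps_unitPl fps_inv_out.

Lemma fps_neq0P a : a != 0 ->
  exists2 n, fpscoef a n != 0 & forall i, (i < n)%N -> fpscoef a i = 0.
Proof.
move=> a0; have exn : exists n, fpscoef a n != 0.
  apply: contrapT => /forallNP an; move/eqP: a0; apply.
  by apply: fpsP => n /=; rewrite if_same; have /negP := an n; rewrite negbK => /eqP.
exists (ex_minn exn); case: ex_minnP => // n _ minn i ltin.
by apply/eqP; apply: contraTT ltin => /minn; rewrite -leqNgt.
Qed.

Fact fps_integral : GRing.integral_domain_axiom (fps R).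
Proof.
move=> a b ab0; apply/norP => -[/fps_neq0P[m am mina] /fps_neq0P[n bn minb]].
have := congr1 (fun c => fpscoef c (m + n)) ab0.
have ltm : (m < (m + n).+1)%N by rewrite ltnS leq_addr.
rewrite /= (bigD1 (Ordinal ltm)) //= addKn big1 ?addr0.
  by rewrite if_same => /eqP; rewrite mulf_eq0 (negPf am) (negPf bn).
move=> i; rewrite -val_eqE /= neq_ltn => /orP[/mina ->|ltmi]; first exact: mul0r.
rewrite minb ?mulr0 // ltn_subLR ?ltn_add2r //.
by rewrite -ltnS ltn_ord.
Qed.

HB.instance Definition _ := GRing.ComUnitRing_isIntegral.Build (fps R) fps_integral.

(* The branch with constant term 1; see [fps_sqrtP] and [fps_sqrt_uniq]. *)
Definition fps_sqrt a : fps R := xget 0 [set s | fpscoef s 0 = 1 /\ s ^+ 2 = a].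

Lemma fps_sqrtP a : fpscoef a 0 = 1 -> (2 : R) \is a GRing.unit ->
  fpscoef (fps_sqrt a) 0 = 1 /\ fps_sqrt a ^+ 2 = a.
Proof.
move=> a0 u2; suff : exists s, fpscoef s 0 = 1 /\ s ^+ 2 = a by move/xgetPex; apply.
pose next (l : seq R) (n : nat) :=
  (fpscoef a n.+1 - \sum_(i < n) l`_i.+1 * l`_(n - i)) / 2.
pose fix L n := if n is m.+1 then rcons (L m) (next (L m) m) else [:: 1].
have szL n : size (L n) = n.+1 by elim: n => //= n IH; rewrite size_rcons IH.
have LE n k : (k <= n)%N -> (L n)`_k = (L k)`_k.
  elim: n => [|n IH]; first by rewrite leqn0 => /eqP ->.
  rewrite leq_eqVlt => /orP[/eqP -> //|kn].
  by rewrite /= nth_rcons szL kn IH.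
pose f n := (L n)`_n; have f0 : f 0 = 1 by [].
have fS n : f n.+1 =
    (fpscoef a n.+1 - \sum_(i < n) f i.+1 * f (n - i)%N) / 2.
  rewrite /f /= nth_rcons szL ltnn eqxx; congr (_ / _); congr (_ - _).
  by apply: eq_bigr => i _; rewrite !(LE n) ?leq_subr.
exists (Fps f); split => //; apply: fpsP => -[|n]; rewrite expr2 /=.
  by rewrite big_ord_recl big_ord0 /= f0 mulr1 addr0 a0.
clearbody f; rewrite big_ord_recl big_ord_recr /= subn0 f0 mul1r /bump /= add1n.
rewrite subnn f0 mulr1 addrCA -mulr2n -mulr_natr fS divrK //.
by rewrite addrC subrK.
Qed.

Lemma fps_sqrt_uniq a s : (2 : R) != 0 ->
  fpscoef s 0 = 1 -> s ^+ 2 = a -> fps_sqrt a = s.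
Proof.
move=> n2 s0 sa; apply: xget_unique => // t [t0 ta]; apply/eqP.
have /eqP : t ^+ 2 = s ^+ 2 by rewrite ta.
rewrite eqf_sqr => /orP[//|/eqP ts]; move: n2; rewrite -t0 in s0.
have := congr1 (fun c => fpscoef c 0) ts; rewrite /= s0 t0 => /eqP.
by rewrite -addr_eq0 => ->.
Qed.

End FpsRing.

Notation "x %:F" := (@FracField.tofrac _ x) : ring_scope.

Local Open Scope nat_scope.

Definition asc (s : seq nat) : nat :=
  #|[set j : 'I_(size s).-1 | nth 0 s j < nth 0 s j.+1]|.

Definition ascent_seq (s : seq nat) : bool :=
  (nth 0 s 0 == 0) &&
  [forall i : 'I_(size s), (0 < i) ==> (nth 0 s i <= asc (take i s) + 1)].

Definition contains (tau s : seq nat) : bool :=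
  [exists f : {ffun 'I_(size tau) -> 'I_(size s)},
    [forall i : 'I_(size tau), forall j : 'I_(size tau), (i < j) ==> (f i < f j)] &&
    [forall i : 'I_(size tau), forall j : 'I_(size tau),
      ((nth 0 s (f i) < nth 0 s (f j)) == (nth 0 tau i < nth 0 tau j)) &&
      ((nth 0 s (f i) > nth 0 s (f j)) == (nth 0 tau i > nth 0 tau j))]].

Definition avoids (tau s : seq nat) : bool := ~~ contains tau s.

Definition fwd (s : seq nat) : nat :=
  \max_(k < (size s).+1 | sorted geq (drop (size s - k) s)) k.

Definition zero (s : seq nat) : nat := count_mem 0 s.

Definition word (n : nat) (t : n.-tuple 'I_n) : seq nat := [seq val i | i <- t].

Lemma asc_le s : asc s <= (size s).-1.
Proof. by rewrite /asc (leq_trans (max_card _)) // card_ord. Qed.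

Lemma ascent_seq_lt s : ascent_seq s -> all (fun k => k < size s) s.
Proof.
case/andP => /eqP s0 /forallP H; apply/(all_nthP 0) => i lti.
have [->|i0] := posnP i; first by rewrite s0 (leq_ltn_trans _ lti).
apply: leq_ltn_trans (lti); move/(_ (Ordinal lti)): H; rewrite /= i0 /= => /leq_trans.
apply; have := asc_le (take i s); rewrite size_take lti -(leq_add2r 1) => /leq_trans.
by apply; rewrite addn1 prednK.
Qed.

(* Entries of an ascent sequence of length n are < n ([ascent_seq_lt]), so
   n-tuples over 'I_n lose none of them. *)
Definition S_ (tau : seq nat) (n : nat) : {set n.-tuple 'I_n} :=
  [set t | ascent_seq (word t) && avoids tau (word t)].

Lemma S_P tau n s :
  (exists2 t, t \in S_ tau n & word t = s) <->
  [/\ size s = n, ascent_seq s & avoids tau s].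
Proof.
split=> [[t + <-]|[sz As av]].
  by rewrite inE => /andP[? ?]; split; rewrite // size_map size_tuple.
have lts := ascent_seq_lt As; rewrite sz in lts.
case: n => [|n] in sz lts *.
  by exists [tuple]; rewrite ?inE /word /=; move/size0nil: sz As av => -> // -> ->.
have szt : size [seq inord k : 'I_n.+1 | k <- s] == n.+1 by rewrite size_map sz.
have ws : word (Tuple szt) = s.
  rewrite /word /= -map_comp -[RHS]map_id; apply/eq_in_map => k ks /=.
  by rewrite inordK // (allP lts).
by exists (Tuple szt); rewrite // inE ws As av.
Qed.

Local Close Scope nat_scope.

(* g(x,y;u,v) as a power series in x; y, u, v may be any elements of the
   coefficient ring, so that specialisations such as v = 1 are g y u 1. *)
Definition g (R : idomainType) (y u v : R) : fps R :=
  Fps (fun n => if n == 0%N then 0 else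
    \sum_(t in S_ [:: 0; 0; 1; 2]%N n | last 0%N (word t) != 0%N)
      y ^+ asc (word t) * u ^+ fwd (word t) * v ^+ zero (word t)).

(* y is the inner and u the outer indeterminate. Divisions take place in the
   fraction field of Q[y,u][[x]], since 2xy and (1-u)(1-ux)+uxy are nonzero
   but not invertible in Q[y,u][[x]]. *)
Notation Qyu := {poly {poly rat}}.
Definition y_ : Qyu := 'X%:P.
Definition u_ : Qyu := 'X.

Definition xF : {fraction fps Qyu} := (fpsX _)%:F.
Definition yF : {fraction fps Qyu} := (fpsC y_)%:F.
Definition uF : {fraction fps Qyu} := (fpsC u_)%:F.

Definition discr : fps Qyu :=
  let x := fpsX _ in let y := fpsC y_ in
  (1 - x * (y + 1)) ^+ 2 - 4 * x ^+ 2 * y.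

Definition kappa : {fraction fps Qyu} :=
  (1 - xF * (yF + 1) - (fps_sqrt discr)%:F) / (2 * xF * yF).

Lemma sqrt_discrP :
  fpscoef (fps_sqrt discr) 0 = 1 /\ fps_sqrt discr ^+ 2 = discr.
Proof.
apply: fps_sqrtP; last first.
  by do 2 rewrite -polyC_natr rmorph_unit //.
rewrite /discr -mulrA mulrCA exprS -mulrA fps_coef0B !fps_coef0M.
by rewrite fps_coef0B fps_coef0M !mul0r !subr0 mulr1.
Qed.

(* Main.v *)
From HB Require Import structures.
Require Import Defs.
From mathcomp Require Import all_boot all_order all_algebra.
From mathcomp Require Import zify ring.

(** Deleting the last 0 of a 0012-avoiding ascent sequence, or the leading 0
    when it is the only one (and then decreasing all the letters), gives again
    such a sequence.  Read backwards, a sequence that does not end in 0 is either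
    a shifted sequence preceded by 0, or is obtained by inserting a 0 before the
    last [t] letters of a sequence that does not end in 0, with [1 <= t <= fwd];
    then [t] is the new value of [fwd], and an ascent is created unless [t] was
    the old one.  With [H(u)] the generating function of all avoiders, including
    the empty one, this amounts to
      (1 - x u) H(u) = 1 + g(u,1),
      (u - 1) g(u,v) = x v ((u - 1) (y (H(u) - 1) + g(u,v)) + y (g(u,v) - u g(1,v))).
    The kernel of the case [v = 1] vanishes at [u = U := 1 + y kappa], which gives
    [H(u) = 1 / (1 - x u U)].  Substituting this for general [v], the kernel
    vanishes at [u = 1 + x y v / (1 - x v)], which gives [g(1,v)]. *)

Set Implicit Arguments.
Unset Strict Implicit.
Unset Printing Implicit Defensive.

Import GRing.Theory.

Local Open Scope nat_scope.

(** * Ascent sequences and the pattern 0012 *)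

Lemma asc_sum s : asc s = \sum_(j < (size s).-1) (nth 0 s j < nth 0 s j.+1).
Proof.
rewrite /asc -sum1dep_card big_mkcond; apply: eq_bigr => i _.
by case: ifP.
Qed.

Lemma asc_cons2 a b s : asc [:: a, b & s] = (a < b) + asc (b :: s).
Proof. by rewrite !asc_sum /= big_ord_recl. Qed.

Lemma asc_le1 s : size s <= 1 -> asc s = 0.
Proof. by case: s => [|a [|]] //= _; rewrite asc_sum big_ord0. Qed.

Lemma asc_cat p a b q :
  asc (rcons p a ++ b :: q) = asc (rcons p a) + (a < b) + asc (b :: q).
Proof.
elim: p => [|c p IH] /=; first by rewrite asc_cons2 [asc [:: a]]asc_le1.
case: p IH => [|d p] IH; first by rewrite /= !asc_cons2 [asc [:: a]]asc_le1 // addn0 addnA.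
by rewrite [rcons _ _]/= [_ ++ _]/= !asc_cons2 -!addnA; congr (_ + _); rewrite IH -!addnA.
Qed.

Lemma asc_rcons s x : asc (rcons s x) = asc s + (last x s < x).
Proof.
case: (lastP s) => [|p a]; first by rewrite /= !asc_le1 // ltnn.
by rewrite -[rcons (rcons _ _) _]cats1 asc_cat last_rcons [asc [:: x]]asc_le1 // addn0.
Qed.

Lemma asc_rcons0 s : asc (rcons s 0) = asc s.
Proof. by rewrite asc_rcons ltn0 addn0. Qed.

Lemma asc_catl p q : asc p <= asc (p ++ q).
Proof.
elim/last_ind: q => [|q x IH]; first by rewrite cats0.
by rewrite -rcons_cat asc_rcons (leq_trans IH) ?leq_addr.
Qed.

Lemma asc_map_succ s : asc [seq x.+1 | x <- s] = asc s.
Proof.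
elim: s => [|a [|b s] IH] //; first by rewrite !asc_le1.
by rewrite asc_cons2 -IH [map _ _]/= asc_cons2.
Qed.

Lemma asc_cons_succ s : s != [::] -> asc (0 :: [seq x.+1 | x <- s]) = (asc s).+1.
Proof. by case: s => // a s _; rewrite map_cons asc_cons2 -map_cons asc_map_succ. Qed.

Lemma ascent_seqP s :
  reflect (nth 0 s 0 = 0 /\
           forall i, 0 < i < size s -> nth 0 s i <= asc (take i s) + 1)
          (ascent_seq s).
Proof.
apply: (iffP andP) => -[/eqP s0 H]; split => //.
  by move=> i /andP[i0 lti]; have /forallP/(_ (Ordinal lti)) := H; rewrite /= i0.
by apply/forallP => i; apply/implyP => i0; apply: H; rewrite i0 ltn_ord.
Qed.

Lemma ascent_seq_rcons s x : s != [::] ->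
  ascent_seq (rcons s x) = ascent_seq s && (x <= asc s + 1).
Proof.
move=> sN; have sz : 0 < size s by case: s sN.
apply/ascent_seqP/andP => [[]|[/ascent_seqP[s0 H] lx]].
  rewrite nth_rcons sz size_rcons => s0 H; split; last first.
    have := H (size s); rewrite sz ltnSn nth_rcons ltnn eqxx => /(_ isT).
    by rewrite -cats1 take_size_cat.
  apply/ascent_seqP; split=> // i /andP[i0 lti].
  have := H i; rewrite i0 ltnS ltnW // nth_rcons lti -cats1 => /(_ isT).
  by rewrite takel_cat // ltnW.
rewrite nth_rcons sz size_rcons; split=> // i /andP[i0].
rewrite ltnS leq_eqVlt => /orP[/eqP ->|lti].
  by rewrite nth_rcons ltnn eqxx -cats1 take_size_cat.
by rewrite nth_rcons lti -cats1 takel_cat ?H ?i0 // ltnW.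
Qed.

Lemma ascent_seq_rcons0 s : ascent_seq (rcons s 0) = ascent_seq s.
Proof.
case: s => [|a s]; last by rewrite ascent_seq_rcons // andbT.
by apply/idP/idP => _; apply/ascent_seqP; split=> // -[|[]].
Qed.

(** Prefixing 0 to the shifted sequence adds one ascent to every nonempty prefix, so each letter and
    its bound grow together; the bound 1 on the second letter forces the first letter of [s] to be
    0. *)
Lemma ascent_seq_succ s : s != [::] ->
  ascent_seq (0 :: [seq x.+1 | x <- s]) = ascent_seq s.
Proof.
elim/last_ind: s => // s x; rewrite map_rcons -rcons_cons => IH _.
rewrite [LHS]ascent_seq_rcons //; case: s IH => [|a s] IH.
  rewrite asc_le1 //; apply/andP/ascent_seqP => [[_ x0]|[/= -> _]]; last first.
    by split=> //; apply/ascent_seqP; split=> // -[|[]].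
  by split=> [|[|[]]] //=; lia.
by rewrite IH // [RHS](@ascent_seq_rcons (a :: s)) // asc_cons_succ // addSn ltnS.
Qed.

(** In a weakly decreasing tail only the first letter has to be checked: later letters are at most
    [b], while the number of ascents of the prefix never drops. *)
Lemma ascent_seq_cat p b q : p != [::] -> sorted geq (b :: q) ->
  ascent_seq (p ++ b :: q) = ascent_seq p && (b <= asc p + 1).
Proof.
move=> pN; elim/last_ind: q => [|q x IH] sq; first by rewrite cats1 ascent_seq_rcons.
have sq' : sorted geq (b :: q).
  move: sq; rewrite -rcons_cons -cats1.
  by apply: (subseq_sorted (rev_trans leq_trans)); rewrite prefix_subseq.
rewrite -rcons_cons -rcons_cat ascent_seq_rcons ?IH //; last by case: (p) pN.
have [|//] := boolP (b <= asc p + 1); last by rewrite !andbF.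
move=> lb; rewrite !andbT; case: (ascent_seq p) => //=.
have lx : x <= b.
  move: sq; rewrite /= (path_sortedE (rev_trans leq_trans)) all_rcons.
  by case/andP => /andP[].
by apply: leq_trans (leq_trans lx lb) _; rewrite leq_add2r asc_catl.
Qed.

Lemma ascent_seq_insert0 p q : p != [::] -> sorted geq q ->
  ascent_seq (p ++ 0 :: q) = ascent_seq (p ++ q).
Proof.
case: q => [|b q] pN sq; first by rewrite cats1 ascent_seq_rcons0 cats0.
rewrite -cat_rcons !ascent_seq_cat //; last by case: (p).
by rewrite ascent_seq_rcons0 asc_rcons0.
Qed.

(** * Occurrences of 0012 as subsequences, under insertion and shifting *)

Lemma subseq_cons_dropP x l s j :
  reflect (exists i, [/\ j <= i < size s, nth 0 s i = x & subseq l (drop i.+1 s)])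
          (subseq (x :: l) (drop j s)).
Proof.
apply: (iffP idP) => [|[i [/andP[ji lti] <- ls]]]; last first.
  apply: subseq_trans (drop_subseq (drop j s) (i - j)).
  by rewrite drop_drop subnK // (drop_nth 0 lti) /= eqxx.
elim: s j => [|y s IH] [|j] //=; last by move/IH => [i [? ? ?]]; exists i.+1.
case: eqP => [<- ls|_]; first by exists 0; rewrite /= drop0.
by rewrite -[X in subseq _ X]drop0 => /IH[i [? ? ?]]; exists i.+1.
Qed.

Definition pat0012 : seq nat := [:: 0; 0; 1; 2].

Lemma contains0012P s :
  reflect (exists a b c, [/\ a < b, b < c & subseq [:: a; a; b; c] s])
          (contains pat0012 s).
Proof.
apply: (iffP existsP) => [[f /andP[/forallP fi /forallP ft]]|[a [b [c [ab bc]]]]].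
  have lt (i j : 'I_4) : i < j -> f i < f j.
    by move=> ij; move/forallP/(_ j)/implyP: (fi i); apply.
  have cmp (i j : 'I_4) := andP (forallP (ft i) j).
  pose o k : 'I_4 := inord k.
  exists (nth 0 s (f (o 0))), (nth 0 s (f (o 2))), (nth 0 s (f (o 3))).
  have [] := cmp (o 0) (o 1); rewrite !inordK //= => /eqP h1 /eqP h2.
  have [+ _] := cmp (o 0) (o 2); rewrite !inordK //= => /eqP ->.
  have [+ _] := cmp (o 2) (o 3); rewrite !inordK //= => /eqP ->.
  have f01 := lt (o 0) (o 1); have f12 := lt (o 1) (o 2); have f23 := lt (o 2) (o 3).
  rewrite !inordK // in f01 f12 f23.
  split=> //; rewrite -[s in subseq _ s]drop0.
  apply/subseq_cons_dropP; exists (f (o 0)); split=> //=.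
  apply/subseq_cons_dropP; exists (f (o 1)); split; first by rewrite f01 /=.
    by move: h1 h2; case: ltngtP.
  apply/subseq_cons_dropP; exists (f (o 2)); split=> //; first by rewrite f12 /=.
  apply/subseq_cons_dropP; exists (f (o 3)); split=> //; first by rewrite f23 /=.
  exact: sub0seq.
rewrite -[s in subseq _ s]drop0.
case/subseq_cons_dropP => i [/= il ia /subseq_cons_dropP[j [/andP[ij jl] ja]]].
case/subseq_cons_dropP => k [/andP[jk kl] kb /subseq_cons_dropP[l [/andP[kl' ll] lc _]]].
pose x := [:: Ordinal il; Ordinal jl; Ordinal kl; Ordinal ll].
exists [ffun t : 'I_4 => nth (Ordinal il) x t]; apply/andP; split.
  apply/forallP => -[[|[|[|[|?]]]] ?] //; apply/forallP => -[[|[|[|[|?]]]] ?] //;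
    by rewrite !ffunE /=; lia.
apply/forallP => -[[|[|[|[|?]]]] ?] //; apply/forallP => -[[|[|[|[|?]]]] ?] //;
  by rewrite !ffunE /= ?ia ?ja ?kb ?lc; lia.
Qed.

Lemma subseq_catP (T : eqType) (l p q : seq T) : subseq l (p ++ q) ->
  exists l1 l2, [/\ l = l1 ++ l2, subseq l1 p & subseq l2 q].
Proof.
case/subseqP => m sm ->; rewrite -(cat_take_drop (size p) m).
have sp : size (take (size p) m) = size p by rewrite size_takel // sm size_cat leq_addr.
by rewrite mask_cat //; do 2 eexists; split; first reflexivity; exact: mask_subseq.
Qed.

(* The only letter of an occurrence [a a b c] that the inserted 0 can play is
   [a], which would leave the ascent [b c] to the weakly decreasing [q]. *)
Lemma avoids_insert0 p q : sorted geq q ->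
  avoids pat0012 (p ++ 0 :: q) = avoids pat0012 (p ++ q).
Proof.
move=> sq; congr (~~ _); apply/contains0012P/contains0012P => -[a [b [c [ab bc h]]]];
  exists a, b, c; split=> //; last first.
  by apply: subseq_trans h _; rewrite subseq_cat2l subseq_cons.
have nbc l : subseq (b :: c :: l) q -> False.
  move/(subseq_sorted (rev_trans leq_trans))/(_ sq) => /= /andP[].
  by rewrite leqNgt bc.
have trans0 l : 0 \notin l -> subseq l (0 :: q) -> subseq l q.
  by case: l => [|x l] /=; rewrite ?sub0seq // inE eq_sym; case: eqP.
have [l1 [l2 [e h1 h2]]] := subseq_catP h; rewrite e; apply: cat_subseq h1 _.
(* Cases by the number of letters found in [p]. With none or one, the inserted 0 can only be matched
   by [a], which leaves [b c] in [q]; with two or more, the rest lies among [b], [c], both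
   positive. *)
case: l1 e => [|x1 [|x2 l1]] /= e.
- rewrite -e /= in h2 *; by move: h2; case: eqP => // _ /cons_subseq /nbc.
- case: e h2 => _ <- /=; case: eqP => [_ /nbc|] //.
case: e => _ _ e; apply: trans0 h2; apply/negP => h0.
have : 0 \in [:: b; c] by rewrite e mem_cat h0 orbT.
by rewrite !inE; lia.
Qed.

Lemma avoids_rcons0 s : avoids pat0012 (rcons s 0) = avoids pat0012 s.
Proof. by rewrite -cats1 avoids_insert0 // cats0. Qed.

(** The leading 0 is the only 0, whereas the smallest letter of an occurrence is used twice; so no
    occurrence uses it. *)
Lemma avoids_succ s :
  avoids pat0012 (0 :: [seq x.+1 | x <- s]) = avoids pat0012 s.
Proof.
congr (~~ _); apply/contains0012P/contains0012P => -[a [b [c [ab bc h]]]]; last first.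
  exists a.+1, b.+1, c.+1; split=> //.
  exact: subseq_trans (map_subseq succn h) (subseq_cons _ _).
have h' : subseq [:: a; a; b; c] [seq x.+1 | x <- s].
  move: h => /=; case: eqP => // -> /mem_subseq /(_ 0).
  by rewrite inE eqxx => /(_ isT) /mapP[].
have a0 : 0 < a by have /mapP[x _ ->] := mem_subseq h' (mem_head _ _).
exists a.-1, b.-1, c.-1; split; try lia.
by move/(map_subseq predn): h'; rewrite -map_comp map_id.
Qed.

(** * The insertion tree *)

Lemma geq_trans : transitive geq.
Proof. exact: rev_trans leq_trans. Qed.

Lemma sorted_geq_cat p q : sorted geq (p ++ q) -> sorted geq p /\ sorted geq q.
Proof.
by move=> h; split; apply: (subseq_sorted geq_trans) h;
  [exact: prefix_subseq | exact: suffix_subseq].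
Qed.

Lemma last_le_sorted_geq s x : sorted geq s -> x \in s -> last 0 s <= x.
Proof.
move=> ss xs; case/splitPr: xs ss => p q.
rewrite last_cat => /sorted_geq_cat[_ /=].
elim: q x => //= b q IH x /andP[xb /IH h]; exact: leq_trans h xb.
Qed.

Lemma fwd_ge p q : sorted geq q -> size q <= fwd (p ++ q).
Proof.
move=> sq; have lt : size q < (size (p ++ q)).+1 by rewrite size_cat ltnS leq_addl.
apply: (@leq_bigmax_cond _ _ _ (Ordinal lt)).
by rewrite /= size_cat addnK drop_size_cat.
Qed.

Lemma sorted_geqP q : (forall b c, subseq [:: b; c] q -> c <= b) -> sorted geq q.
Proof.
elim: q => // b [|c q] IH h //; apply/andP; split.
  by apply: h; rewrite /= !eqxx sub0seq.
by apply: IH => b' c' h'; apply: h; apply: subseq_trans h' (subseq_cons _ _).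
Qed.

(** A longer suffix would contain the strict ascent into [b]. With [descent_suffix], this computes
    [fwd] for every nonempty sequence. *)
Lemma fwd_cat p b q : sorted geq (b :: q) -> (p == [::]) || (last 0 p < b) ->
  fwd (p ++ b :: q) = (size q).+1.
Proof.
move=> sq pb; apply/eqP; rewrite eqn_leq; apply/andP; split.
  apply/bigmax_leqP => -[k /= lek]; rewrite ltnS size_cat /= in lek *.
  case/orP: pb => [/eqP p0 _|pb]; first by rewrite p0 in lek.
  rewrite drop_cat; case: ltnP => [lt|]; last by lia.
  have : drop (size p + (size q).+1 - k) p != [::].
    by rewrite -size_eq0 size_drop subn_eq0 -ltnNge.
  have /esym := cat_take_drop (size p + (size q).+1 - k) p.
  case/lastP: (drop _ p) => // r x /(congr1 (last 0)).
  rewrite last_cat last_rcons => ex _; rewrite cat_rcons.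
  by case/sorted_geq_cat => _ /= /andP[]; rewrite -ex leqNgt pb.
exact: (fwd_ge p sq).
Qed.

Lemma descent_suffix s : s != [::] -> exists p b q,
  [/\ s = p ++ b :: q, sorted geq (b :: q) & (p == [::]) || (last 0 p < b)].
Proof.
elim: s => // x [|y s] IH _; first by exists [::], x, [::].
have [//|[|z p] [b [q [-> sq pb]]]] := IH; last by exists (x :: z :: p), b, q.
have [xb|bx] := ltnP x b; first by exists [:: x], b, q.
by exists [::], x, (b :: q); split=> //; apply/andP.
Qed.

Lemma fwd_rcons0 s : fwd (rcons s 0) = (fwd s).+1.
Proof.
have [->|/descent_suffix[p [b [q [-> sq pb]]]]] := eqVneq s [::].
  rewrite -[rcons _ _]/([::] ++ [:: 0]) fwd_cat // /fwd.
  by rewrite big_ord_recl big_ord0.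
rewrite rcons_cat rcons_cons !fwd_cat ?size_rcons //.
by move: sq; rewrite /= rcons_path => ->.
Qed.

Lemma fwd_succ s : s != [::] -> fwd (0 :: [seq x.+1 | x <- s]) = fwd s.
Proof.
case/descent_suffix => p [b [q [-> sq pb]]].
rewrite map_cat -cat_cons !fwd_cat ?size_map //; first by rewrite /= path_map.
by case/lastP: p pb => [|p x]; rewrite // map_rcons /= !last_rcons ltnS; case: p.
Qed.

(** * Inserting a 0 into the final weakly decreasing run *)

Definition insert0 (t : nat) (s : seq nat) : seq nat :=
  take (size s - t) s ++ 0 :: drop (size s - t) s.

Lemma insert0_cat p q : insert0 (size q) (p ++ q) = p ++ 0 :: q.
Proof. by rewrite /insert0 size_cat addnK take_size_cat ?drop_size_cat. Qed.

(** Shape of [s] around the insertion place. The tail has no 0, since it decreases weakly to a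
    nonzero letter; an ascent already crosses the place exactly when it is the start of the final
    run. *)
Lemma insert0_spec s t : nth 0 s 0 = 0 -> last 0 s != 0 -> 0 < t <= fwd s ->
  exists p b q, [/\ s = p ++ b :: q, p != [::], sorted geq (b :: q), 0 \notin b :: q &
    (size q).+1 = t /\ (last 0 p < b) = (t == fwd s)].
Proof.
move=> s0 sl; have /descent_suffix[p0 [b0 [q0 [es sq pb]]]] : s != [::] by case: (s) sl.
rewrite {1 3}es fwd_cat // => /andP[t0 tf].
(* A sequence starting with 0 and weakly decreasing throughout would end in 0. *)
have p0N : p0 != [::].
  apply: contra sl => /eqP p0N; rewrite es p0N cat0s in s0 *.
  rewrite -leqn0 -[X in _ <= X]s0; apply: (last_le_sorted_geq sq); exact: mem_head.
rewrite (negPf p0N) /= in pb.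
set r := b0 :: q0 in es sq; set d := size r - t.
have dr : d < size r by rewrite /d /=; lia.
have er := cat_take_drop d r; rewrite (drop_nth 0 dr) in er.
have szq : (size (drop d.+1 r)).+1 = t by rewrite size_drop /d /=; move: tf; rewrite /=; lia.
exists (p0 ++ take d r), (nth 0 r d), (drop d.+1 r).
have sr : sorted geq (nth 0 r d :: drop d.+1 r).
  by move: sq; rewrite -{1}er => /sorted_geq_cat[].
split.
- by rewrite -catA er.
- by case: (p0) p0N.
- by [].
- apply/negP => /(last_le_sorted_geq sr); rewrite leqn0 => /eqP l0.
  by move: sl; rewrite es -er !last_cat /= -[last _ _]/(last 0 (_ :: _)) l0.
split=> //; have [d0|d0] := posnP d.
  by rewrite d0 take0 cats0 /= pb; apply/esym/eqP; rewrite -szq d0 /= drop0.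
have -> : (t == (size q0).+1) = false by apply/eqP => et; move: d0; rewrite /d et /= subnn.
rewrite last_cat; case/lastP: (take d r) (size_takel (ltnW dr)) er => [/esym d0'|r' x _].
  by rewrite d0' in d0.
rewrite last_rcons cat_rcons => er; move: sq; rewrite -{1}er => /sorted_geq_cat[_ /=].
by rewrite ltnNge => /andP[->].
Qed.

Lemma fwd_insert0 p b q : 0 < b -> sorted geq (b :: q) ->
  fwd (p ++ 0 :: b :: q) = (size q).+1.
Proof. by move=> b0 sq; rewrite -cat_rcons fwd_cat // last_rcons b0 orbT. Qed.

(** The new ascent from 0 to [b] replaces the comparison of [last 0 p] with [b], so the count
    changes only if that one was not an ascent. *)
Lemma asc_insert0 p b q : p != [::] -> 0 < b ->
  asc (p ++ 0 :: b :: q) = asc (p ++ b :: q) + ~~ (last 0 p < b).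
Proof.
case/lastP: p => // p a _ b0; rewrite -cat_rcons !asc_cat asc_rcons0 b0 last_rcons.
by case: (a < b); rewrite /= ?addn0 ?addn1 ?addnS ?addSn.
Qed.

(** * Lists of avoiders, for reindexing sums, and their decomposition by the last 0 *)

Definition avoiders (n : nat) : seq (seq nat) :=
  [seq word t | t <- enum (S_ pat0012 n)].

Lemma mem_avoiders n s : (s \in avoiders n) =
  [&& size s == n, ascent_seq s & avoids pat0012 s].
Proof.
apply/mapP/and3P => [[t + ->]|[/eqP sz As Av]].
  rewrite mem_enum => St.
  have [->] : [/\ size (word t) = n, ascent_seq (word t) & avoids pat0012 (word t)].
    by apply/S_P; exists t.
  by split.
have /S_P[t St <-] : [/\ size s = n, ascent_seq s & avoids pat0012 s] by [].
by exists t; rewrite ?mem_enum.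
Qed.

Lemma avoiders_uniq n : uniq (avoiders n).
Proof.
rewrite map_inj_uniq ?enum_uniq // => t1 t2 /(inj_map val_inj) e.
exact: val_inj.
Qed.

(** By the default value of [last], the empty sequence counts as ending in 0 and is left out. *)
Definition nz_avoiders n := [seq s <- avoiders n | last 0 s != 0].

Lemma nz_avoiders_uniq n : uniq (nz_avoiders n).
Proof. exact/filter_uniq/avoiders_uniq. Qed.

Lemma perm_avoiders n :
  perm_eq (avoiders n.+1) (nz_avoiders n.+1 ++ [seq rcons s 0 | s <- avoiders n]).
Proof.
apply: uniq_perm; rewrite ?avoiders_uniq // ?cat_uniq.
  rewrite nz_avoiders_uniq map_inj_uniq ?avoiders_uniq ?andbT /=; last exact: rcons_injl.
  apply/hasPn => s' /mapP[s _ ->]; by rewrite mem_filter last_rcons eqxx.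
move=> s; rewrite mem_cat mem_filter; have [l0|] := eqVneq (last 0 s) 0; last first.
  move=> l0; have /negPf -> : s \notin [seq rcons r 0 | r <- avoiders n]; last by rewrite orbF.
  by apply: contra l0 => /mapP[r _ ->]; rewrite last_rcons.
case/lastP: s l0 => [_|s x]; first by rewrite mem_avoiders; apply/esym/mapP => -[[]].
rewrite last_rcons => ->; rewrite (mem_map (rcons_injl _)) !mem_avoiders.
by rewrite size_rcons eqSS ascent_seq_rcons0 avoids_rcons0.
Qed.

Lemma split_last0 (s : seq nat) : 0 \in s -> exists p q, s = p ++ 0 :: q /\ 0 \notin q.
Proof.
elim: s => // x s IH; rewrite inE; have [s0 _|s0] := boolP (0 \in s).
  by have [p [q [-> q0]]] := IH s0; exists (x :: p), q.
by rewrite orbF => /eqP <-; exists [::], s.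
Qed.

Lemma head_avoiders n s : s \in avoiders n -> nth 0 s 0 = 0.
Proof. by rewrite mem_avoiders => /and3P[_ /ascent_seqP[]]. Qed.

Lemma nz_avoidersP n s t : s \in nz_avoiders n -> t \in iota 1 (fwd s) ->
  exists p b q, [/\ s = p ++ b :: q, p != [::], sorted geq (b :: q), 0 \notin b :: q &
    (size q).+1 = t /\ (last 0 p < b) = (t == fwd s)].
Proof.
rewrite mem_filter mem_iota add1n ltnS => /andP[sl /head_avoiders s0].
exact: insert0_spec.
Qed.

Lemma perm_nz_avoiders n :
  perm_eq (nz_avoiders n.+2)
    ([seq 0 :: [seq x.+1 | x <- s] | s <- avoiders n.+1] ++
     [seq insert0 t s | s <- nz_avoiders n.+1, t <- iota 1 (fwd s)]).
Proof.
apply: uniq_perm; first exact: nz_avoiders_uniq.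
  rewrite cat_uniq map_inj_uniq ?avoiders_uniq /=; last first.
    by move=> s1 s2 [] /(inj_map succn_inj).
  apply/andP; split.
    (* The two families are disjoint: an insertion leaves a 0 after the leading one, a shifted
       sequence has none. *)
    apply/hasPn => _ /allpairsPdep[s [t [sT tI ->]]]; apply/negP => /mapP[r _].
    have [p [b [q [-> pN _ _ [<- _]]]]] := nz_avoidersP sT tI.
    rewrite -[(size q).+1]/(size (b :: q)) insert0_cat.
    case: p pN => // a p _ [_ e].
    have : 0 \in [seq x.+1 | x <- r] by rewrite -e mem_cat mem_head orbT.
    by case/mapP.
  (* Insertion is injective: no 0 follows the inserted one, so it is recovered as the last 0. *)
  apply: allpairs_uniq_dep => [|s _|]; rewrite ?nz_avoiders_uniq ?iota_uniq //.
  move=> _ _ /allpairsPdep[s1 [t1 [sT1 tI1 ->]]] /allpairsPdep[s2 [t2 [sT2 tI2 ->]]] /=.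
  have [p1 [b1 [q1 [-> _ _ n1 [<- _]]]]] := nz_avoidersP sT1 tI1.
  have [p2 [b2 [q2 [-> _ _ n2 [<- _]]]]] := nz_avoidersP sT2 tI2.
  rewrite -[(size q1).+1]/(size (b1 :: q1)) -[(size q2).+1]/(size (b2 :: q2)) !insert0_cat.
  move: (b1 :: q1) (b2 :: q2) n1 n2 => r1 r2 n1 n2.
  elim: p1 p2 => [|x p1 IH] [|y p2] /= [] //.
  - by move=> ->.
  - by move=> _ e; rewrite e mem_cat mem_head orbT in n1.
  - by move=> _ e; rewrite -e mem_cat mem_head orbT in n2.
  by move=> -> /IH [-> ->].
move=> s; rewrite mem_cat mem_filter.
apply/andP/orP => [[sl sA]|[/mapP[r + ->]|/allpairsPdep[r [t [rT tI ->]]]]].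
- have s0 := head_avoiders sA; move: sA; rewrite mem_avoiders => /and3P[/eqP sz As Av].
  case: s s0 sl sz As Av => // _ s /= -> sl [sz] As Av.
  have [/split_last0[p [q [es q0]]]|s0] := boolP (0 \in s); last first.
    have es : s = [seq x.+1 | x <- map predn s].
      rewrite -map_comp -[LHS]map_id; apply/eq_in_map => x xs /=.
      by rewrite prednK // lt0n; apply: contraNneq s0 => <-.
    left; apply/mapP; exists (map predn s); last by rewrite -es.
    rewrite mem_avoiders size_map sz eqxx /=; rewrite es in As Av.
    by rewrite -avoids_succ Av andbT -ascent_seq_succ //; case: (s) sz.
  (* An ascent [b c] after the last 0 would form 0012 with that 0 and the leading one. *)
  have sq : sorted geq q.
    apply: sorted_geqP => b c bc; rewrite leqNgt; apply/negP => ltbc.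
    case/negP: Av; apply/contains0012P; exists 0, b, c; split=> //.
      by rewrite lt0n; apply: contraNneq q0 => <-; apply: (mem_subseq bc); rewrite mem_head.
    rewrite es /=; apply: subseq_trans (suffix_subseq p _); by rewrite /= bc.
  have qN : q != [::] by apply: contraNneq sl => qE; rewrite es qE last_cat.
  right; apply/allpairsPdep; exists ((0 :: p) ++ q), (size q).
  rewrite insert0_cat es; split=> //; last first.
    by rewrite mem_iota lt0n size_eq0 qN add1n ltnS fwd_ge.
  rewrite mem_filter mem_avoiders -ascent_seq_insert0 // -avoids_insert0 //= -es As Av.
  rewrite -eqSS -sz es !size_cat /= addnS eqxx.
  by move: sl; rewrite es !last_cat /=; case: (q) qN => //= ? ? _ ->.
- rewrite !mem_avoiders /= size_map eqSS => /and3P[sz As Av].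
  have rN : r != [::] by case: (r) sz.
  rewrite sz ascent_seq_succ // As avoids_succ Av; split=> //.
  by case/lastP: (r) rN => // ? ? _; rewrite map_rcons last_rcons.
have [p [b [q [er pN sq q0 [<- _]]]]] := nz_avoidersP rT tI.
move: rT; rewrite mem_filter er -[(size q).+1]/(size (b :: q)) insert0_cat.
rewrite !mem_avoiders ascent_seq_insert0 // avoids_insert0 // => /and3P[rl sz ->].
by split; [move: rl; rewrite !last_cat | move: sz; rewrite !size_cat /= !addnS !eqSS => ->].
Qed.

Lemma fwd_gt0 s : s != [::] -> 0 < fwd s.
Proof. by case/descent_suffix => p [b [q [-> sq pb]]]; rewrite fwd_cat. Qed.

Lemma stat_insert0 n s t : s \in nz_avoiders n -> t \in iota 1 (fwd s) ->
  [/\ asc (insert0 t s) = asc s + (t != fwd s), fwd (insert0 t s) = t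
    & zero (insert0 t s) = (zero s).+1].
Proof.
move=> sT tI; have [p [b [q [es pN sq q0 [et tf]]]]] := nz_avoidersP sT tI.
have b0 : 0 < b by rewrite lt0n; apply: contraNneq q0 => ->; rewrite mem_head.
rewrite -tf es -et -[(size q).+1]/(size (b :: q)) insert0_cat asc_insert0 //.
by rewrite fwd_insert0 // /zero !count_cat /=; split=> //; lia.
Qed.

Local Open Scope ring_scope.

(** * Formal power series *)

Section FpsCoef.
Variable R : idomainType.
Implicit Types (a b : fps R) (c : R) (n : nat).

Lemma coef_fpsD a b n : fpscoef (a + b) n = fpscoef a n + fpscoef b n.
Proof. by []. Qed.

Lemma coef_fpsN a n : fpscoef (- a) n = - fpscoef a n.
Proof. by []. Qed.

Lemma coef_fpsB a b n : fpscoef (a - b) n = fpscoef a n - fpscoef b n.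
Proof. by []. Qed.

Lemma coef_fps0 n : fpscoef (0 : fps R) n = 0.
Proof. by rewrite /= if_same. Qed.

Lemma coef_fps1 n : fpscoef (1 : fps R) n = (n == 0%N)%:R.
Proof. by rewrite /=; case: eqP. Qed.

Lemma coef_fpsCM c a n : fpscoef (fpsC c * a) n = c * fpscoef a n.
Proof.
by rewrite /= big_ord_recl /= subn0 big1 ?addr0 // => i _; rewrite mul0r.
Qed.

Lemma coef_fpsXM0 a : fpscoef (fpsX R * a) 0 = 0.
Proof. by rewrite fps_coef0M mul0r. Qed.

Lemma coef_fpsXMS a n : fpscoef (fpsX R * a) n.+1 = fpscoef a n.
Proof.
rewrite /= big_ord_recl mul0r add0r big_ord_recl /= mul1r subSS subn0.
by rewrite big1 ?addr0 // => i _; rewrite mul0r.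
Qed.

Lemma fpsC_is_zmod_morphism : zmod_morphism (@fpsC R).
Proof. by move=> c d; apply: fpsP => -[|n] //=; rewrite subr0. Qed.

Lemma fpsC_is_monoid_morphism : monoid_morphism (@fpsC R).
Proof.
split=> // c d; apply: fpsP => n; rewrite coef_fpsCM /=.
by case: ifP; rewrite ?mulr0.
Qed.

HB.instance Definition _ :=
  GRing.isZmodMorphism.Build R (fps R) (@fpsC R) fpsC_is_zmod_morphism.
HB.instance Definition _ :=
  GRing.isMonoidMorphism.Build R (fps R) (@fpsC R) fpsC_is_monoid_morphism.

End FpsCoef.

(** Used with [polyC], to adjoin an indeterminate to the coefficients, and with evaluation, to
    specialise it. *)
Definition map_fps (R S : idomainType) (f : R -> S) (a : fps R) : fps S :=
  Fps (fun n => f (fpscoef a n)).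

Section MapFps.
Variables (R S : idomainType) (f : {rmorphism R -> S}).

Lemma map_fps_is_zmod_morphism : zmod_morphism (map_fps f).
Proof. by move=> a b; apply: fpsP => n; rewrite /= rmorphB. Qed.

Lemma map_fps_is_monoid_morphism : monoid_morphism (map_fps f).
Proof.
split=> [|a b]; apply: fpsP => n; rewrite /=.
  by case: ifP; rewrite ?rmorph1 ?rmorph0.
by rewrite rmorph_sum; apply: eq_bigr => i _; rewrite rmorphM.
Qed.

HB.instance Definition _ :=
  GRing.isZmodMorphism.Build (fps R) (fps S) (map_fps f) map_fps_is_zmod_morphism.
HB.instance Definition _ :=
  GRing.isMonoidMorphism.Build (fps R) (fps S) (map_fps f) map_fps_is_monoid_morphism.

Lemma map_fpsX : map_fps f (fpsX R) = fpsX S.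
Proof. by apply: fpsP => n; rewrite /= rmorph_nat. Qed.

Lemma map_fpsC c : map_fps f (fpsC c) = fpsC (f c).
Proof. by apply: fpsP => n /=; case: ifP; rewrite ?rmorph0. Qed.

End MapFps.

(** * Functional equations and their solution *)

Section FunctionalEquations.
Variable R : idomainType.
Implicit Types y u v : R.

Lemma coef_g y u v n : fpscoef (g y u v) n =
  \sum_(s <- nz_avoiders n) y ^+ asc s * u ^+ fwd s * v ^+ zero s.
Proof.
rewrite /nz_avoiders big_filter /avoiders big_map big_enum_cond /=.
case: eqP => // ->; rewrite big1 // => t /andP[_].
by rewrite (tuple0 t).
Qed.

(** The series H of the overview; its constant term 1 comes from the empty sequence. *)
Definition avoiders_gf y u : fps R :=
  Fps (fun n => \sum_(s <- avoiders n) y ^+ asc s * u ^+ fwd s).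

Lemma avoiders0 : avoiders 0 = [:: [::]].
Proof.
apply: perm_small_eq => //; apply: uniq_perm; rewrite ?avoiders_uniq // => s.
rewrite mem_avoiders inE; case: s => [|x s] //=.
apply/andP; split; first by apply/ascent_seqP; split=> // -[].
by apply/contains0012P => -[a [b [c [_ _ /=]]]].
Qed.

Lemma nz_avoiders1 : nz_avoiders 1 = [::].
Proof.
apply/eqP; rewrite -[_ == _]negbK -has_filter; apply/hasPn => s sA.
rewrite negbK; have := head_avoiders sA; move: sA; rewrite mem_avoiders.
by case/andP; case: s => [|x []] //= _ _ ->.
Qed.

(** A trailing 0 contributes the factor x u: it adds one to the length and to [fwd], and no
    ascent. *)
Lemma avoiders_gf_eq y u :
  (1 - fpsX R * fpsC u) * avoiders_gf y u = 1 + g y u 1.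
Proof.
apply: fpsP => -[|n]; rewrite mulrBl mul1r -mulrA coef_fpsB coef_fpsD coef_fps1 coef_g.
  rewrite coef_fpsXM0 /nz_avoiders /= avoiders0 /= big_seq1 big_nil /fwd big_ord_recl big_ord0.
  by rewrite asc_le1 // mulr1 subr0 addr0.
rewrite coef_fpsXMS coef_fpsCM /= (perm_big _ (perm_avoiders n)) big_cat /= big_map add0r.
rewrite mulr_sumr -addrA -sumrB /= [X in _ + X]big1 ?addr0 => [|s _].
  by apply: eq_bigr => s _; rewrite expr1n mulr1.
by rewrite asc_rcons0 fwd_rcons0 exprS; ring.
Qed.

(** Total weight of the insertions into one sequence whose [fwd] is [f.+1]; only the place
    [t = f.+1] creates no ascent. The factor [u - 1] sums the geometric series without division. *)
Lemma sum_insert0 y u a f :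
  (u - 1) * \sum_(t <- iota 1 f.+1) y ^+ (a + (t != f.+1)) * u ^+ t =
  y ^+ a * ((u - 1) * u ^+ f.+1 + y * (u ^+ f.+1 - u)).
Proof.
have geo : (u - 1) * \sum_(t <- iota 1 f) u ^+ t = u ^+ f.+1 - u.
  elim: f => [|f IH]; first by rewrite big_nil mulr0 subrr.
  by rewrite -[f.+1]addn1 iotaD big_cat /= big_seq1 mulrDr IH add1n addn1 [u ^+ f.+2]exprS; ring.
rewrite -[X in iota _ X]addn1 iotaD big_cat /= big_seq1 add1n eqxx addn0 mulrDr.
rewrite (eq_big_seq (fun t => y ^+ a.+1 * u ^+ t)) => [|t]; last first.
  by rewrite mem_iota add1n => /andP[_ /ltn_eqF ->]; rewrite addn1.
by rewrite -mulr_sumr mulrCA geo exprS; ring.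
Qed.

(** Weighted form of [perm_nz_avoiders]. Shifted sequences have one 0 and one more ascent, which
    gives the term in [avoiders_gf y u - 1]; the other terms come from insertions. The coefficients
    of degree 0 and 1 vanish on both sides. *)
Lemma g_eq y u v :
  (fpsC u - 1) * g y u v = fpsX R * (fpsC v *
    ((fpsC u - 1) * (fpsC y * (avoiders_gf y u - 1) + g y u v) +
     fpsC y * (g y u v - fpsC u * g y 1 v))).
Proof.
rewrite -(rmorph1 (@fpsC R)) -(rmorphB (@fpsC R)); apply: fpsP => -[|[|n]].
- by rewrite coef_fpsXM0 coef_fpsCM coef_g /nz_avoiders avoiders0 /= big_nil mulr0.
- rewrite coef_fpsXMS !coef_fpsCM !coef_fpsD !coef_fpsCM !coef_fpsD !coef_fpsN !coef_fpsCM.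
  rewrite !coef_g nz_avoiders1 /nz_avoiders /= avoiders0 /= !big_nil big_seq1.
  by rewrite asc_le1 // /fwd big_ord_recl big_ord0 /= !mulr1; ring.
rewrite coef_fpsXMS !coef_fpsCM !coef_fpsD !coef_fpsCM !coef_fpsD !coef_fpsN !coef_fpsCM.
rewrite !coef_g /= subr0 (perm_big _ (perm_nz_avoiders n)) big_cat big_map big_allpairs_dep /=.
rewrite mulrDr [X in _ + X]mulr_sumr.
set A := nz_avoiders n.+1.
rewrite [X in _ + X = _](eq_big_seq (fun s =>
  v * ((u - 1) * (y ^+ asc s * u ^+ fwd s * v ^+ zero s) +
  y * (y ^+ asc s * u ^+ fwd s * v ^+ zero s -
  u * (y ^+ asc s * 1 ^+ fwd s * v ^+ zero s))))); last first.
  move=> s sA; rewrite (eq_big_seq (fun t => v ^+ (zero s).+1 *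
      (y ^+ (asc s + (t != fwd s)) * u ^+ t))) => [|t tI]; last first.
    by have [-> -> ->] := stat_insert0 sA tI; rewrite mulrC.
  have sN : s != [::] by move: sA; rewrite mem_filter; case: (s).
  rewrite -mulr_sumr mulrCA; case: (fwd s) (fwd_gt0 sN) => // f _.
  by rewrite sum_insert0 expr1n exprS; ring.
rewrite -mulr_sumr big_split /= -!mulr_sumr sumrB -mulr_sumr.
rewrite [X in _ * X + _](eq_big_seq (fun s => v * y * (y ^+ asc s * u ^+ fwd s)))
  => [|s sA]; last first.
  have sN : s != [::] by move: sA; rewrite mem_avoiders; case: (s).
  rewrite asc_cons_succ // fwd_succ // exprS /zero /=.
  have -> : count_mem 0%N [seq x.+1 | x <- s] = 0%N by elim: (s).
  by rewrite expr1; ring.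
by rewrite -mulr_sumr; ring.
Qed.
End FunctionalEquations.

(** * Change of coefficient ring *)

Section Naturality.
Variables (R S : idomainType) (f : {rmorphism R -> S}).

Lemma map_fps_g y u v : map_fps f (g y u v) = g (f y) (f u) (f v).
Proof.
apply: fpsP => n; rewrite coef_g -[LHS]/(f (fpscoef _ n)) coef_g rmorph_sum.
by apply: eq_bigr => s _; rewrite !rmorphM !rmorphXn.
Qed.

Lemma map_fps_avoiders_gf y u :
  map_fps f (avoiders_gf y u) = avoiders_gf (f y) (f u).
Proof.
apply: fpsP => n /=; rewrite rmorph_sum.
by apply: eq_bigr => s _; rewrite !rmorphM !rmorphXn.
Qed.
End Naturality.

(** * Nonzero series and the kernel method *)

Section FpsNeq0.
Variable R : idomainType.

Lemma fps_coef0_neq0 (a : fps R) : fpscoef a 0 != 0 -> a != 0.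
Proof. by apply: contra => /eqP ->. Qed.

Lemma fpsX_neq0 : fpsX R != 0.
Proof.
apply/eqP => /(congr1 (fun a => fpscoef a 1)) /eqP.
by rewrite coef_fps0 /= oner_eq0.
Qed.

Lemma oneBX_neq0 (a : fps R) : 1 - fpsX R * a != 0.
Proof. by apply: fps_coef0_neq0; rewrite coef_fpsB coef_fpsXM0 subr0 oner_neq0. Qed.

Lemma fpsC_neq0 (c : R) : c != 0 -> fpsC c != 0.
Proof. by move=> c0; apply: fps_coef0_neq0. Qed.

(* The kernel method: [fpsC 'X - p] vanishes at ['X = p], so it divides no
   nonzero series that is free of ['X]. *)
Lemma kernel_const (c p : fps R) (Q : fps {poly R}) :
  (fpsC 'X - map_fps polyC p) * Q = map_fps polyC c -> c = 0.
Proof.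
have [-> /esym|/fps_neq0P[n Qn Qlt] eQ] := eqVneq Q 0.
  rewrite mulr0 => c0; apply: fpsP => n; apply: polyC_inj.
  by rewrite coef_fps0 -[LHS]/(fpscoef (map_fps polyC c) n) c0 coef_fps0.
(* At the lowest nonzero coefficient of [Q], the left side has degree at least 1 in ['X] and the
   right side is constant. *)
have : ('X - (fpscoef p 0)%:P) * fpscoef Q n = (fpscoef c n)%:P.
  rewrite -[RHS]/(fpscoef (map_fps polyC c) n) -eQ /= big_ord_recl subn0 big1 ?addr0 //.
  by move=> i _; rewrite Qlt ?mulr0 // lift0 subnSK // leq_subr.
move/(congr1 (fun q : {poly R} => size q)); rewrite size_mul ?polyXsubC_eq0 // size_XsubC.
rewrite -size_poly_gt0 in Qn; case: (size (fpscoef Q n)) Qn => // k _ e.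
by have := size_polyC_leq1 (fpscoef c n); rewrite -e.
Qed.

End FpsNeq0.

(** * Polynomial identities behind the two kernels *)

Section Algebra.
Variable A : comPzRingType.
Implicit Types x y u v p U H G : A.

(** As a quadratic in u, the kernel is 1 - (1 + x - x y) u + x u^2. One root is U and the product of
    the roots is 1/x, so the other is 1/(x U). *)
Lemma kernel_factor x y u U : x * U ^+ 2 + 1 = (1 + x - x * y) * U ->
  (U - u) * (1 - x * U * u) = U * ((1 - u) * (1 - u * x) + u * x * y).
Proof.
move=> eU; transitivity (U - u * (x * U ^+ 2 + 1) + x * U * u ^+ 2); first ring.
by rewrite eU; ring.
Qed.

Lemma fwd_kernel x y u U H G (G1 : A) : x * U ^+ 2 + 1 = (1 + x - x * y) * U ->
  (1 - x * u) * H = 1 + G ->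
  (u - 1) * G = x * (1 * ((u - 1) * (y * (H - 1) + G) + y * (G - u * G1))) ->
  (1 - x) * (U - u) * ((1 - x * U * u) * (H - 1)) =
    U * x * u * (1 - x + x * y + y * G1 - (1 - x) * u).
Proof.
move=> eU eH; have -> : G = (1 - x * u) * H - 1 by rewrite eH; ring.
move=> eG; rewrite mulrA -[(1 - x) * _ * _]mulrA (kernel_factor _ eU).
apply/eqP; rewrite -subr_eq0; apply/eqP.
transitivity (- U * ((u - 1) * ((1 - x * u) * H - 1) - x * (1 * ((u - 1) * (y * (H - 1) +
  ((1 - x * u) * H - 1)) + y * (((1 - x * u) * H - 1) - u * G1))))); first by ring.
by rewrite -eG subrr mulr0.
Qed.

(** The coefficient of G is (u - 1)(1 - x v) - x y v = (1 - x v)(u - p); the factor 1 - x U u clears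
    H. *)
Lemma zero_kernel x y u v p U H G (G1 : A) : (p - 1) * (1 - x * v) = x * y * v ->
  (1 - x * U * u) * H = 1 ->
  (u - 1) * G = x * (v * ((u - 1) * (y * (H - 1) + G) + y * (G - u * G1))) ->
  (1 - x * v) * (u - p) * ((1 - x * U * u) * G) =
    x * v * y * u * (x * U * (1 + G1) * u - (x * U + G1)).
Proof.
move=> ep eH eG; apply/eqP; rewrite -subr_eq0; apply/eqP.
transitivity ((1 - x * U * u) * ((u - 1) * G - x * (v * ((u - 1) * (y * (H - 1) + G) +
   y * (G - u * G1)))) - (1 - x * U * u) * G * ((p - 1) * (1 - x * v) - x * y * v) +
   x * v * y * (u - 1) * ((1 - x * U * u) * H - 1)); first by ring.
by rewrite eG ep eH !subrr !mulr0 !addr0 ?subrr.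
Qed.

End Algebra.

(** * Solution of the functional equations from a root [U] of the kernel *)

Section Solve.
Variables (R : idomainType) (y : R) (U : fps R).
Let x := fpsX R.
Hypothesis eU : x * U ^+ 2 + 1 = (1 + x - x * fpsC y) * U.

Lemma kernel_root_neq0 : U != 0.
Proof.
apply/eqP => U0; move: eU; rewrite U0 expr0n !mulr0 add0r => /eqP.
by rewrite oner_eq0.
Qed.

Let x' := fpsX {poly R}.
Let y' : fps {poly R} := fpsC y%:P.
Let u' : fps {poly R} := fpsC 'X.
Let U' := map_fps polyC U.

Lemma kernel_root_polyC : x' * U' ^+ 2 + 1 = (1 + x' - x' * y') * U'.
Proof.
have := congr1 (map_fps polyC) eU.
by rewrite !(rmorphD, rmorphM, rmorphB, rmorphN, rmorph1, rmorphXn) /= map_fpsX map_fpsC.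
Qed.

(** Here u is an indeterminate, so that [kernel_const] applies: putting u = U determines the unknown
    g(1,1), after which the factor (1 - x)(U - u) cancels. *)
Lemma avoiders_gf_polyX : (1 - x' * U' * u') * avoiders_gf y%:P 'X = 1.
Proof.
have eH := avoiders_gf_eq y%:P 'X.
have eG := g_eq y%:P 'X 1; rewrite (rmorph1 (@fpsC _)) in eG.
have := fwd_kernel kernel_root_polyC eH eG; set H := avoiders_gf _ _; rewrite -/x' -/u' -/y'.
set G1 := g _ 1 1 => K.
have eG1 : G1 = map_fps polyC (g y 1 1) by rewrite map_fps_g /= !rmorph1.
pose B := 1 - x + x * fpsC y + fpsC y * g y 1 1.
have eB : 1 - x' + x' * y' + y' * G1 = map_fps polyC B.
  by rewrite !(rmorphD, rmorphM, rmorphB, rmorphN, rmorph1) /= map_fpsX !map_fpsC eG1.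
clearbody B; rewrite eB in K; set B' := map_fps polyC B in K.
have /eqP : U * x * U * (B - (1 - x) * U) = 0.
  (* The second summand of the quotient is the divided difference, between u and U, of the right
     side of [K], which is polynomial in u. *)
  apply: (@kernel_const _ _ U (- ((1 - x') * ((1 - x' * U' * u') * (H - 1)))
     - U' * x' * (B' - (1 - x') * (u' + U')))).
  transitivity ((1 - x') * (U' - u') * ((1 - x' * U' * u') * (H - 1)) -
     U' * x' * u' * (B' - (1 - x') * u') + U' * x' * U' * (B' - (1 - x') * U')); first ring.
  rewrite K subrr add0r.
  by rewrite !(rmorphD, rmorphM, rmorphB, rmorphN, rmorph1) /= map_fpsX.
rewrite !mulf_eq0 !(negPf kernel_root_neq0) (negPf (fpsX_neq0 _)) /= subr_eq0 => /eqP BE.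
have B'E : B' = (1 - x') * U'.
  by rewrite /B' BE rmorphM rmorphB rmorph1 /= map_fpsX.
have Uu : U' - u' != 0.
  rewrite -oppr_eq0 opprB; apply: fps_coef0_neq0; rewrite coef_fpsB /=.
  by rewrite polyXsubC_eq0.
have x1 : 1 - x' != 0 by rewrite -[x']mulr1 oneBX_neq0.
have : (1 - x' * U' * u') * (H - 1) = x' * U' * u'.
  apply: (mulfI (mulf_neq0 x1 Uu)); rewrite K B'E; ring.
move=> e; transitivity ((1 - x' * U' * u') * (H - 1) + (1 - x' * U' * u')); first ring.
by rewrite e; ring.
Qed.

Lemma avoiders_gfE u : (1 - x * U * fpsC u) * avoiders_gf y u = 1.
Proof.
have eUu : map_fps (horner_eval u) U' = U.
  by apply: fpsP => n /=; rewrite /horner_eval hornerC.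
have := congr1 (map_fps (horner_eval u)) avoiders_gf_polyX.
rewrite rmorphM rmorphB !rmorphM !rmorph1 /= map_fpsX map_fpsC map_fps_avoiders_gf.
by rewrite /= eUu /horner_eval hornerX hornerC.
Qed.

Lemma g_fwdE u : (1 - x * U * fpsC u) * g y u 1 = x * fpsC u * (U - 1).
Proof.
have -> : g y u 1 = (1 - x * fpsC u) * avoiders_gf y u - 1.
  by rewrite avoiders_gf_eq addrC addKr.
by rewrite mulrBr mulrCA avoiders_gfE; ring.
Qed.

Lemma geometric v : (1 - x * fpsC v) * Fps (fun n => v ^+ n) = 1.
Proof.
apply: fpsP => -[|n]; rewrite mulrBl mul1r -mulrA coef_fpsB coef_fps1.
  by rewrite coef_fpsXM0 subr0.
by rewrite coef_fpsXMS coef_fpsCM /= exprS subrr.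
Qed.

Lemma g_zeroE v : y != 0 -> v != 0 ->
  (1 - x * fpsC v - x * U * (1 - x * fpsC v + x * fpsC y * fpsC v)) * g y 1 v =
  x ^+ 2 * fpsC y * fpsC v * U.
Proof.
move=> y0 v0; set g1 := g y 1 v; set vF := fpsC v; set yF := fpsC y.
(* The kernel root 1 + x y v / (1 - x v), the inverse being written as a geometric series. *)
pose p := 1 + x * yF * vF * Fps (fun n => v ^+ n).
have ep : (p - 1) * (1 - x * vF) = x * yF * vF.
  by rewrite /p addrC addKr -mulrA [_ * (1 - _)]mulrC geometric mulr1.
have p0 : p != 0.
  apply: fps_coef0_neq0; rewrite coef_fpsD -!mulrA coef_fpsXM0 addr0 coef_fps1; exact: oner_neq0.
clearbody p; pose p' := map_fps polyC p; pose v' : fps {poly R} := fpsC v%:P.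
pose g1' := map_fps polyC g1.
have ep' : (p' - 1) * (1 - x' * v') = x' * y' * v'.
  have := congr1 (map_fps polyC) ep.
  by rewrite !(rmorphD, rmorphM, rmorphB, rmorphN, rmorph1) /= map_fpsX !map_fpsC.
have eG := g_eq y%:P 'X v%:P.
have eg1 : g y%:P 1 v%:P = g1' by rewrite /g1' map_fps_g /= rmorph1.
rewrite eg1 in eG; have := zero_kernel ep' avoiders_gf_polyX eG.
set G := g _ _ _; rewrite -/u' => K.
have /eqP : x * vF * yF * p * (x * U * (1 + g1) * p - (x * U + g1)) = 0.
  apply: (@kernel_const _ _ p ((1 - x' * v') * ((1 - x' * U' * u') * G) -
     x' * v' * y' * (x' * U' * (1 + g1') * (u' + p') - (x' * U' + g1')))).
  transitivity ((1 - x' * v') * (u' - p') * ((1 - x' * U' * u') * G) -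
    x' * v' * y' * u' * (x' * U' * (1 + g1') * u' - (x' * U' + g1')) +
    x' * v' * y' * p' * (x' * U' * (1 + g1') * p' - (x' * U' + g1'))); first by rewrite -/p'; ring.
  rewrite K subrr add0r.
  by rewrite !(rmorphD, rmorphM, rmorphB, rmorphN, rmorph1) /= map_fpsX !map_fpsC.
rewrite !mulf_eq0 (negPf p0) (negPf (fpsX_neq0 _)) (negPf (fpsC_neq0 y0)) (negPf (fpsC_neq0 v0)) /=.
move/eqP => e; apply/eqP; rewrite -subr_eq0; apply/eqP.
(* Multiplying by 1 - x v eliminates p from the relation obtained at u = p. *)
transitivity (- (1 - x * vF) * (x * U * (1 + g1) * p - (x * U + g1)) +
   x * U * (1 + g1) * ((p - 1) * (1 - x * vF) - x * yF * vF)); first by ring.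
by rewrite e ep subrr !mulr0 addr0.
Qed.

(** Both series are explicit quotients in U; after cross-multiplication they differ by a multiple of
    the equation of U. *)
Lemma g_fwd_zero u : y != 0 -> u != 0 -> g y u 1 = g y 1 u.
Proof.
move=> y0 u0; have e1 := g_fwdE u; have e2 := g_zeroE y0 u0.
set uF := fpsC u in e1 e2; set yF := fpsC y in e2.
pose D := 1 - x * uF - x * U * (1 - x * uF + x * yF * uF); rewrite -/D in e2.
have D0 : D != 0.
  apply: fps_coef0_neq0; rewrite /D !coef_fpsB -mulrA !coef_fpsXM0 !subr0; exact: oner_neq0.
have k0 : 1 - x * U * uF != 0 by rewrite -mulrA oneBX_neq0.
apply: (mulfI (mulf_neq0 k0 D0)); rewrite -[RHS]mulrA e2 mulrAC e1.
apply/eqP; rewrite -subr_eq0; apply/eqP.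
transitivity (- x * uF * (1 - x * uF) * (x * U ^+ 2 + 1 - (1 + x - x * yF) * U)).
  by rewrite /D; ring.
by rewrite eU subrr mulr0.
Qed.

Lemma g_fwd_closed u :
  g y u 1 * ((1 - fpsC u) * (1 - fpsC u * x) + fpsC u * x * fpsC y) =
  fpsC u * x * (1 - fpsC u * x) * (U - 1) - fpsC u ^+ 2 * x ^+ 2 * fpsC y.
Proof.
apply: (mulfI kernel_root_neq0); rewrite mulrCA -(kernel_factor _ eU).
rewrite mulrCA [g y u 1 * _]mulrC g_fwdE.
apply/eqP; rewrite -subr_eq0; apply/eqP; set uF := fpsC u.
transitivity (x * uF ^+ 2 * (x * U ^+ 2 + 1 - (1 + x - x * fpsC y) * U)); first by ring.
by rewrite eU subrr mulr0.
Qed.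

End Solve.

(** With the square root written as 1 + x - x y - 2 x V, the fraction defining kappa becomes (V -
    1)/y. *)
Lemma kappa_root (F : fieldType) (x y z V : F) : (2 : F) != 0 -> x != 0 -> y != 0 ->
  z * x * y * (1 - z * x) *
    ((1 - x * (y + 1) - (1 + x - x * y - 2 * (x * V))) / (2 * x * y)) =
  z * x * (1 - z * x) * (V - 1).
Proof. by move=> n2 x0 y0; field; rewrite n2 x0 y0. Qed.

(** * The root [U] from the square root, and the formula in the fraction field *)

Section Fraction.
Variables (R : idomainType) (y : R) (s : fps R).
Hypotheses (unit2 : (2 : R) \is a GRing.unit) (s0 : fpscoef s 0 = 1).
Hypothesis s2 : s ^+ 2 =
  (1 - fpsX R * (fpsC y + 1)) ^+ 2 - 4 * fpsX R ^+ 2 * fpsC y.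

Lemma two_neq0 : (2 : R) != 0.
Proof. by apply: contraTneq unit2 => ->; rewrite unitr0. Qed.

Lemma fps2_neq0 : (2 : fps R) != 0.
Proof. by rewrite -(rmorph_nat (@fpsC R)); apply/fpsC_neq0/two_neq0. Qed.

(** The choice of branch enters here: since [s] has constant term 1, the numerator 1 + x - x y - s
    is divisible by 2 x. *)
Lemma kernel_root_exists : exists2 U : fps R,
  fpsX R * U ^+ 2 + 1 = (1 + fpsX R - fpsX R * fpsC y) * U &
  s = 1 + fpsX R - fpsX R * fpsC y - 2 * (fpsX R * U).
Proof.
move: s2; set x := fpsX R; set yC := fpsC y; pose w := 1 + x - x * yC - s => s2'.
pose U := Fps (fun n => 2^-1 * fpscoef w n.+1).
have eU : 2 * (x * U) = w.
  have -> : 2 = fpsC (2 : R) by rewrite rmorph_nat.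
  apply: fpsP => -[|n]; rewrite coef_fpsCM; last by rewrite coef_fpsXMS /= mulrA mulrV ?mul1r.
  rewrite coef_fpsXM0 mulr0 /w 2!coef_fpsB coef_fpsD s0 coef_fpsXM0 subr0 coef_fps1.
  by have -> : fpscoef x 0 = 0 by []; rewrite addr0 subrr.
exists U; last by rewrite eU /w; ring.
(* Multiplication by 4 x completes the square; the discriminant equals (1 + x - x y)^2 - 4 x. *)
have n4 : 2 * 2 * x != 0 by rewrite !mulf_neq0 ?fps2_neq0 ?fpsX_neq0.
apply: (mulfI n4).
transitivity ((2 * (x * U)) ^+ 2 + 4 * x); first ring.
transitivity (2 * (1 + x - x * yC) * (2 * (x * U))); last ring.
rewrite eU /w; apply/eqP; rewrite -subr_eq0; apply/eqP.
transitivity (s ^+ 2 - ((1 - x * (yC + 1)) ^+ 2 - 4 * x ^+ 2 * yC)); first ring.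
by rewrite s2' subrr.
Qed.

Lemma g_fwd_fraction u : y != 0 -> u != 1 ->
  let x := (fpsX R)%:F in let yC := (fpsC y)%:F in let uC := (fpsC u)%:F in
  (g y u 1)%:F =
    (uC * x * yC * (1 - uC * x) * ((1 - x * (yC + 1) - s%:F) / (2 * x * yC))
       - uC ^+ 2 * x ^+ 2 * yC)
      / ((1 - uC) * (1 - uC * x) + uC * x * yC).
Proof.
move=> y0 u1 x yC uC; have [U eU es] := kernel_root_exists.
have yC0 : yC != 0 by rewrite tofrac_eq0 fpsC_neq0.
have x0 : x != 0 by rewrite tofrac_eq0 fpsX_neq0.
have n2 : (2 : {fraction fps R}) != 0.
  by rewrite -(rmorph_nat (@FracField.tofrac _)) tofrac_eq0 fps2_neq0.
have esF : s%:F = 1 + x - x * yC - 2 * (x * U%:F).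
  by rewrite {1}es !(rmorphB, rmorphD, rmorphM, rmorph1, rmorph_nat).
(* Its constant term in x is 1 - u. *)
have K0 : (1 - uC) * (1 - uC * x) + uC * x * yC != 0.
  have -> : (1 - uC) * (1 - uC * x) + uC * x * yC =
    ((1 - fpsC u) * (1 - fpsC u * fpsX _) + fpsC u * fpsX _ * fpsC y)%:F.
    by rewrite !(rmorphB, rmorphD, rmorphM, rmorph1).
  rewrite tofrac_eq0; apply: fps_coef0_neq0.
  rewrite coef_fpsD !fps_coef0M !coef_fpsB fps_coef0M /= !mulr0 !subr0 mul0r addr0 mulr1.
  by rewrite subr_eq0 eq_sym.
apply: (canRL (mulfK K0)).
have := congr1 (@FracField.tofrac _) (g_fwd_closed eU u).
rewrite !(rmorphB, rmorphD, rmorphM, rmorph1, rmorphXn) /= -/x -/yC -/uC => ->.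
by rewrite esF (kappa_root _ _ n2 x0 yC0).
Qed.

End Fraction.

Theorem theorem1 :
  g y_ u_ 1 = g y_ 1 u_ /\
  (g y_ u_ 1)%:F =
    (uF * xF * yF * (1 - uF * xF) * kappa - uF ^+ 2 * xF ^+ 2 * yF)
      / ((1 - uF) * (1 - uF * xF) + uF * xF * yF).
Proof.
have y0 : y_ != 0 by rewrite polyC_eq0 polyX_eq0.
have u0 : u_ != 0 by rewrite polyX_eq0.
have u1 : u_ != 1 by rewrite -subr_eq0 -polyC1 polyXsubC_eq0.
have unit2 : (2 : Qyu) \is a GRing.unit by do 2 rewrite -polyC_natr rmorph_unit //.
have [s0 s2] := sqrt_discrP.
split; last exact: (g_fwd_fraction unit2 s0 s2 y0 u1).
have [U eU _] := kernel_root_exists unit2 s0 s2.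
exact: (g_fwd_zero eU y0 u0).
Qed.
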